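(* There are infinitely many pairs of positive integers $(n,m)$ for which the graph $\mathcal{C}(n,m)$ is Laplacian integral, i.e. all eigenvalues of its Laplacian matrix are integers.
   Context: For positive integers $n,m$, $\mathcal{C}(n,m)$ is the graph with vertex set $\{u_j : j\in\mathbb{Z}_n\}\cup\{v_{t,j}: 1\le t\le m,\ j\in\mathbb{Z}_n\}$ whose edges are: $v_{t,j}v_{t,j'}$ for all $t$ and all $j\ne j'$ (so each set $\{v_{t,j}: j\in\mathbb{Z}_n\}$ induces a complete graph $K_n$), and $u_jv_{t,j}$ for all $t$ and $j$; there are no other edges (in particular the $u_j$ are pairwise nonadjacent). (Equivalently, it is the $n$-symmetric join of the empty graph $\overline{K}_n$ with $m$ disjoint copies of $K_n$.) The Laplacian matrix is $L(G)=D(G)-A(G)$. *)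

(* Defs.v *)
From HB Require Import structures.
From mathcomp Require Import all_boot all_order all_algebra all_field.

Set Implicit Arguments.
Unset Strict Implicit.
Unset Printing Implicit Defensive.

Import GRing.Theory.

Local Open Scope ring_scope.

(* A finite simple graph on a finType T is given by its adjacency relation,
   a symmetric and irreflexive [rel T]. Matrices of the graph are indexed by
   ['I_#|T|] through the canonical enumeration [enum_val]. *)
Section GraphMatrices.

Variables (R : nzRingType) (T : finType) (e : rel T).

Definition degree (x : T) : nat := #|[set y | e x y]|.

Definition adjacency_mx : 'M[R]_#|T| :=
  \matrix_(i, j) (e (enum_val i) (enum_val j))%:R.

Definition degree_mx : 'M[R]_#|T| :=
  diag_mx (\row_i (degree (enum_val i))%:R).

Definition laplacian_mx : 'M[R]_#|T| := degree_mx - adjacency_mx.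

End GraphMatrices.

(* All eigenvalues are taken in the algebraic complex numbers, which contain
   every complex eigenvalue of a matrix with integer entries. *)
Definition laplacian_integral (T : finType) (e : rel T) : Prop :=
  forall a : algC, eigenvalue (laplacian_mx algC e) a -> a \in Num.int.

(* [inl j] is u_j and [inr (t, j)] is v_{t,j}. Only equality of the indices j
   matters, so Z_n is rendered by ['I_n], which unlike ['Z_n] has exactly n
   elements also for n = 1. *)
Definition Cvertex (n m : nat) : finType := ('I_n + 'I_m * 'I_n)%type.

Definition Cgraph (n m : nat) : rel (Cvertex n m) :=
  fun x y => match x, y with
  | inl _, inl _ => false
  | inl j, inr (_, j') => j == j'
  | inr (_, j), inl j' => j == j'
  | inr (t, j), inr (t', j') => (t == t') && (j != j')
  end.

Lemma Cgraph_sym (n m : nat) : symmetric (@Cgraph n m).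
Proof.
by move=> [j|[t j]] [j'|[t' j']] //=; rewrite eq_sym // (eq_sym j).
Qed.

Lemma Cgraph_irrefl (n m : nat) : irreflexive (@Cgraph n m).
Proof. by move=> [j|[t j]] //=; rewrite !eqxx. Qed.

(* Main.v *)
Require Import Defs.
From HB Require Import structures.
From mathcomp Require Import all_boot all_order all_algebra all_field.
From mathcomp Require Import boolp classical_sets functions cardinality.
From mathcomp Require Import ring.

Local Open Scope classical_set_scope.

(** An eigenvector of [C(n,m)] for [a] is a family [x_j, y_{t,j}] with
    [m x_j - sum_t y_{t,j} = a x_j] and
    [(n + 1) y_{t,j} - S_t - x_j = a y_{t,j}], where [S_t = sum_j y_{t,j}].
    Put [X = sum_j x_j]. Summation gives [(1 - a) S_t = X], hence
    [a (a - (m + 1)) X = 0]. If [X = 0] then [a = 1] or all [S_t] vanish, and in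
    the latter case [a = n + 1] or [a^2 - (n + m + 1) a + n m = 0]. For
    [n = m = k (k + 1)] this quadratic has the roots [k^2] and [(k + 1)^2]. *)

Section CgraphSpectrum.
Import GRing.Theory Num.Theory.
Local Open Scope ring_scope.

(** Relabelling a row eigenvector by [enum_rank] lets the eigenvalue equation be read vertex by
    vertex. As [eigenvalue] refers to left eigenvectors, the sum runs over [e y x]. *)
Lemma laplacian_eigenfunction (F : fieldType) (T : finType) (e : rel T) (a : F) :
  eigenvalue (laplacian_mx F e) a ->
  exists2 f : T -> F, (exists x, f x != 0) &
    forall x, (degree e x)%:R * f x - \sum_(y | e y x) f y = a * f x.
Proof.
case/eigenvalueP=> v /rowP vL v_neq0.
exists (fun x => v ord0 (enum_rank x)).
  by have /rV0Pn[i vi] := v_neq0; exists (enum_val i); rewrite enum_valK.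
move=> x; have := vL (enum_rank x).
rewrite mulmxBr !mxE => <-; congr (_ - _).
  rewrite (bigD1 (enum_rank x)) //= big1 => [|i /negPf ix].
    by rewrite !mxE eqxx mulr1n enum_rankK addr0 mulrC.
  by rewrite !mxE ix mulr0n mulr0.
rewrite (reindex enum_rank) /=; last exact/onW_bij/enum_rank_bij.
rewrite big_mkcond /=; apply: eq_bigr => y _.
by rewrite !mxE !enum_rankK; case: ifP => _; rewrite ?mulr1 ?mulr0.
Qed.

Lemma sum_Cgraph_inl (n m : nat) (V : nmodType) (f : Cvertex n m -> V) (j : 'I_n) :
  \sum_(y | Cgraph y (inl j)) f y = \sum_t f (inr (t, j)).
Proof.
rewrite big_sumType /= big_pred0_eq add0r.
rewrite [RHS](eq_bigr (fun t => \sum_(j' | j' == j) f (inr (t, j')))); last first.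
  by move=> t _; rewrite big_pred1_eq.
by rewrite pair_big; apply: eq_big => -[].
Qed.

Lemma sum_Cgraph_inr (n m : nat) (V : nmodType) (f : Cvertex n m -> V)
    (t : 'I_m) (j : 'I_n) :
  \sum_(y | Cgraph y (inr (t, j))) f y =
  f (inl j) + \sum_(j' | j' != j) f (inr (t, j')).
Proof.
rewrite big_sumType /= big_pred1_eq; congr (_ + _).
transitivity (\sum_(t' | t' == t) \sum_(j' | j' != j) f (inr (t', j'))).
  by rewrite pair_big; apply: eq_big => -[].
by rewrite big_pred1_eq.
Qed.

(** With this form, the two neighbour sums above, taken at the constant function 1, also give the
    degrees. *)
Lemma degree_sum1 (T : finType) (e : rel T) (x : T) :
  symmetric e -> degree e x = (\sum_(y | e y x) 1)%N.
Proof.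
by move=> e_sym; rewrite sum1_card; apply: eq_card => y; rewrite inE e_sym.
Qed.

Lemma degree_Cgraph_inl (n m : nat) (j : 'I_n) :
  degree (@Cgraph n m) (inl j) = m.
Proof.
rewrite degree_sum1; last exact: Cgraph_sym.
by rewrite (sum_Cgraph_inl _ _ nat (fun=> 1%N)) sum1_card card_ord.
Qed.

Lemma degree_Cgraph_inr (n m : nat) (t : 'I_m) (j : 'I_n) :
  degree (@Cgraph n m) (inr (t, j)) = n.
Proof.
rewrite degree_sum1; last exact: Cgraph_sym.
rewrite (sum_Cgraph_inr _ _ nat (fun=> 1%N)).
by rewrite -[RHS]card_ord -sum1_card [RHS](bigD1 j).
Qed.

Lemma eigenvalue_Cgraph (F : fieldType) (n m : nat) (a : F) :
  eigenvalue (laplacian_mx F (@Cgraph n m)) a ->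
  a * (a - m.+1%:R) * (a - 1) * (a - n.+1%:R) *
    (a ^+ 2 - (n + m).+1%:R * a + (n * m)%:R) = 0.
Proof.
case/laplacian_eigenfunction=> f [z fz] fE.
pose S t := \sum_j f (inr (t, j)); pose X := \sum_j f (inl j).
have xE j : m%:R * f (inl j) - \sum_t f (inr (t, j)) = a * f (inl j).
  by rewrite -fE degree_Cgraph_inl sum_Cgraph_inl.
(* Adding the missing term [j' = j] completes the sum to [S t] and raises the degree [n] to
   [n.+1]. *)
have yE t j : n.+1%:R * f (inr (t, j)) - S t - f (inl j) = a * f (inr (t, j)).
  rewrite -fE degree_Cgraph_inr sum_Cgraph_inr /S (bigD1 j) //= -natr1; ring.
have SE t : (1 - a) * S t = X.
  have : \sum_j (n.+1%:R * f (inr (t, j)) - S t - f (inl j)) = a * S t.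
    by rewrite mulr_sumr; apply: eq_bigr.
  rewrite !sumrB -mulr_sumr -/(S t) -/X sumr_const card_ord -[S t *+ n]mulr_natl.
  by rewrite -natr1 mulrBl => <-; ring.
have XE : (m%:R - a) * X = \sum_t S t.
  rewrite /S exchange_big mulr_sumr /=; apply: eq_bigr => j _.
  by rewrite mulrBl -xE; ring.
(* Eliminating the [S t] leaves the factor [(1 - a) * (m - a) - m = a * (a - (m + 1))]. *)
have aX : a * (a - m.+1%:R) * X = 0.
  have : (1 - a) * ((m%:R - a) * X) = m%:R * X.
    rewrite XE mulr_sumr (eq_bigr (fun=> X)) // sumr_const card_ord.
    by rewrite mulr_natl.
  by move/eqP; rewrite -subr_eq0 -natr1 => /eqP <-; ring.
(* If no factor vanishes, then [X], every [S t], every [x_j] and finally every [y_{t,j}] is zero,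
   against [f z != 0]. *)
apply/eqP; apply: contraNT fz => nz.
move: nz; rewrite !mulf_eq0 !negb_or => /andP[/andP[/andP[/andP[a0 am] a1] an] q0].
have X0 : X = 0.
  by move/eqP: aX; rewrite !mulf_eq0 (negPf a0) (negPf am) => /eqP.
have S0 t : S t = 0.
  move/eqP: (SE t); rewrite X0 mulf_eq0 subr_eq0 eq_sym -subr_eq0 (negPf a1).
  by move/eqP.
have yx t j : (n.+1%:R - a) * f (inr (t, j)) = f (inl j).
  by rewrite mulrBl -yE S0; ring.
have x0 j : f (inl j) = 0.
  have xy : (m%:R - a) * f (inl j) = \sum_t f (inr (t, j)).
    by rewrite mulrBl -xE; ring.
  (* Eliminating the [y_{t,j}] produces the quadratic factor. *)
  have : (n.+1%:R - a) * ((m%:R - a) * f (inl j)) = m%:R * f (inl j).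
    rewrite xy mulr_sumr (eq_bigr (fun=> f (inl j))) // sumr_const card_ord.
    by rewrite mulr_natl.
  move/eqP; rewrite -subr_eq0.
  have -> : (n.+1%:R - a) * ((m%:R - a) * f (inl j)) - m%:R * f (inl j) =
      (a ^+ 2 - (n + m).+1%:R * a + (n * m)%:R) * f (inl j).
    by rewrite -!natr1 natrD natrM; ring.
  by rewrite mulf_eq0 (negPf q0) => /eqP.
case: z => [j|[t j]]; first by rewrite x0.
move/eqP: (yx t j); rewrite x0 mulf_eq0 subr_eq0 eq_sym -subr_eq0 (negPf an).
by [].
Qed.

Lemma laplacian_integral_Cgraph_pronic (k : nat) :
  laplacian_integral (@Cgraph (k * k.+1) (k * k.+1)).
Proof.
move=> a /eigenvalue_Cgraph.
(* Here [k^2 + (k + 1)^2 = 2 k (k + 1) + 1], and the product of the two squares is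
   [(k (k + 1))^2]. *)
have -> : a ^+ 2 - (k * k.+1 + k * k.+1).+1%:R * a + (k * k.+1 * (k * k.+1))%:R
    = (a - (k ^ 2)%:R) * (a - (k.+1 ^ 2)%:R).
  by rewrite !natrX -natr1 !(natrD, natrM) -natr1; ring.
move/eqP; rewrite !mulf_eq0 !subr_eq0 -!orbA.
by do 5?[case/orP]; move/eqP=> ->; rewrite ?rpred0 ?rpred1 ?rpred_nat.
Qed.

End CgraphSpectrum.

Theorem theorem1p2 :
  infinite_set [set p : nat * nat |
    (0 < p.1)%N /\ (0 < p.2)%N /\ laplacian_integral (@Cgraph p.1 p.2)].
Proof.
(* The shift to [k.+1] keeps both entries positive. *)
pose f k := (k.+1 * k.+2, k.+1 * k.+2).
have f_inj : injective f.
  apply: (inj_compr (f := fst)); apply: (incn_inj (f := fst \o f)).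
  by apply: leq_mono => i j ij; rewrite /f /= ltn_mul.
(* Were the set finite, so would be its preimage under the injective [f], which is all of [nat]. *)
move=> /(finite_preimage (in2W f_inj)) fin; apply: infinite_nat.
apply: sub_finite_set fin => k _ /=; do 2?split=> //.
exact: laplacian_integral_Cgraph_pronic.
Qed.
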